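(* Let $n\ge 2$. A linear map $\phi:\langle\mathbf{DS}_n\rangle\to\langle\mathbf{DS}_n\rangle$ preserves the spectrum, that is, $$\operatorname{spec}(\phi(A))=\operatorname{spec}(A)\qquad\text{for all }A\in\langle\mathbf{DS}_n\rangle,$$ if and only if $\phi$ has one of the following forms: (1) when $n=2$: $\phi(A)=PAP^{-1}$ for all $A\in\langle\mathbf{DS}_2\rangle$, for some $P\in\left\{I_2,\begin{pmatrix}1&0\\0&-1\end{pmatrix}\right\}$; (2) when $n\ge 3$: there is an invertible $P\in\langle\mathbf{DS}_n\rangle$ such that either $\phi(A)=PAP^{-1}$ for all $A\in\langle\mathbf{DS}_n\rangle$, or $\phi(A)=PA^tP^{-1}$ for all $A\in\langle\mathbf{DS}_n\rangle$.
   Context: $\mathbf{DS}_n$ is the set of $n\times n$ doubly stochastic matrices (real, entrywise nonnegative, all row sums and all column sums equal to $1$). $\langle\mathbf{DS}_n\rangle$ is its real linear span; with $e=(1,\ldots,1)^t\in\mathbb{R}^n$, it equals $\{A\in M_n(\mathbb{R}): Ae=ce,\ e^tA=ce^t \text{ for some } c\in\mathbb{R}\}$. Linear means $\mathbb{R}$-linear. $A^t$ is the transpose of $A$. $\operatorname{spec}(A)$ is the spectrum (multiset of complex eigenvalues) of $A$ counting multiplicities. *)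

(* Defs.v *)
From HB Require Import structures.
From mathcomp Require Import all_boot all_order all_algebra.
From mathcomp Require Import finmap multiset complex.
From mathcomp Require Import boolp reals.

Set Implicit Arguments.
Unset Strict Implicit.
Unset Printing Implicit Defensive.

Import Order.TTheory GRing.Theory Num.Theory.
Local Open Scope ring_scope.

Definition doubly_stochastic (R : realType) (n : nat) (A : 'M[R]_n) : Prop :=
  [/\ forall i j, 0 <= A i j,
      forall i, \sum_j A i j = 1
    & forall j, \sum_i A i j = 1].

Definition ds_span (R : realType) (n : nat) : {pred 'M[R]_n} :=
  fun A => `[< exists (m : nat) (a : 'I_m -> R) (D : 'I_m -> 'M[R]_n),
                 (forall k, doubly_stochastic (D k)) /\
                 A = \sum_k a k *: D k >].

Arguments ds_span : clear implicits.

Lemma ds_span_submod (R : realType) (n : nat) : submod_closed (ds_span R n).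
Proof.
split=> [|c A B /asboolP[m [a [D [dsD ->]]]] /asboolP[p [b [E [dsE ->]]]]].
  apply/asboolP; exists 0%N, (fun=> 0), (fun=> 0).
  by split=> [[]|] //; rewrite big_ord0.
apply/asboolP; exists (m + p)%N,
  (fun k => match split k with inl i => c * a i | inr j => b j end),
  (fun k => match split k with inl i => D i | inr j => E j end).
split=> [k|]; first by case: (split k).
rewrite big_split_ord /= scaler_sumr; congr (_ + _); apply: eq_bigr => i _.
  by rewrite (unsplitK (inl i : 'I_m + 'I_p)) scalerA.
by rewrite (unsplitK (inr i : 'I_m + 'I_p)).
Qed.

HB.instance Definition _ (R : realType) (n : nat) :=
  GRing.isSubmodClosed.Build R 'M[R]_n (ds_span R n) (@ds_span_submod R n).

Record dsSpan (R : realType) (n : nat) := DsSpan {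
  ds_mx :> 'M[R]_n;
  ds_mxP : ds_mx \in ds_span R n
}.

HB.instance Definition _ (R : realType) (n : nat) :=
  [isSub for @ds_mx R n].
HB.instance Definition _ (R : realType) (n : nat) :=
  [Choice of dsSpan R n by <:].
HB.instance Definition _ (R : realType) (n : nat) :=
  [SubChoice_isSubLmodule of dsSpan R n by <:].

(* The multiset of roots in R[i] of the (monic) characteristic polynomial. *)
Definition spec (R : realType) (n : nat) (A : 'M[R]_n) : {mset R[i]}%mset :=
  seq_mset (sval (closed_field_poly_normal
    (char_poly (map_mx (real_complex R) A)))).

(* For n = 2 this is the matrix with rows (1, 0) and (0, -1). *)
Definition alt_sign_mx (R : realType) (n : nat) : 'M[R]_n :=
  diag_mx (\row_(j < n) (-1) ^+ j).

Arguments alt_sign_mx : clear implicits.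

(* Main.v *)
From HB Require Import structures.
Require Import Defs.
From mathcomp Require Import all_boot all_order all_algebra.
From mathcomp Require Import finmap multiset complex.
From mathcomp Require Import boolp reals.
From mathcomp Require Import perm ring lra.

Set Implicit Arguments.
Unset Strict Implicit.
Unset Printing Implicit Defensive.

Import Order.TTheory GRing.Theory Num.Theory.
Local Open Scope ring_scope.

(** With e the all-ones vector, the span of the doubly stochastic matrices
    consists of the matrices A for which e is both a right and a left
    eigenvector for one common eigenvalue c.  In the basis made of e and of
    e_j - e_0 for j > 0 such an A becomes block diagonal with blocks c and B,
    where B is an arbitrary square matrix of size m = n - 1 ([ds_spanP],
    [ds_span_diag_block]).  So phi becomes a linear map
    (c, B) |-> (c', B') with
    ('X - c') * char_poly B' = ('X - c) * char_poly B.

    If m > 1, then c' = c.  Indeed c' = c * alpha + f(B) is linear in (c, B)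
    and is always c or an eigenvalue of B.  Square-zero matrices have no
    eigenvalue but 0, so f vanishes on the matrix units off the diagonal, hence
    on the permutation matrix of a derangement, which is invertible; with
    this B and a generic c one gets alpha = 1, and then for any B a generic c
    gives f(B) = 0 ([corner_scale_eq1], [corner0]).  Cancelling,
    B' = c K + psi(B) has the characteristic polynomial of B for every c, and
    comparing the traces of the squares gives K = 0 ([lower_shift0]).

    It remains to see that a linear map psi of the full matrix algebra which
    preserves characteristic polynomials is B |-> Q B Q^-1 or
    B |-> Q B^T Q^-1.  Triangularization over the complex numbers shows that psi
    preserves the traces of squares and cubes ([char_poly_eq_mxtraceX]).
    Polarization gives tr (psi A psi B) = tr (A B) and
    tr ((psi A)^2 psi B) = tr (A^2 B), so that psi is bijective and, the trace
    form being nondegenerate, psi (A^2) = (psi A)^2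
    ([trace_preserver_sqr]): psi is a Jordan automorphism.  It maps the
    diagonal matrix units to orthogonal idempotents, which may be assumed to
    be the diagonal matrix units themselves ([jordan_idem_simultaneous]); the
    Jordan relations then send each E_ij to a multiple of E_ij or of E_ji, the
    same alternative for all i <> j ([jordan_off_diag], [jordan_same_type]), and
    the scalars are removed by a diagonal conjugation
    ([jordan_units_scaled]).

    If n = 2, the span has basis 1, X with X the swap matrix, and the traces of
    phi(A) and of its square force phi to fix 1 and to send X to X or to -X.
*)

(** * Spectra, characteristic polynomials and traces of powers *)

Lemma char_poly_conj (F : comUnitRingType) n (P A : 'M[F]_n) : P \in unitmx ->
  char_poly (P *m A *m invmx P) = char_poly A.
Proof.
move=> Pu; pose p := map_mx (@polyC F) P; pose q := map_mx (@polyC F) (invmx P).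
have pq : p *m q = 1%:M by rewrite -map_mxM mulmxV // map_mx1.
have -> : char_poly (P *m A *m invmx P) = \det (p *m char_poly_mx A *m q).
  congr (\det _); rewrite /char_poly_mx mulmxBr mulmxBl !map_mxM.
  by rewrite [p *m 'X%:M]scalar_mxC -[_ *m p *m q]mulmxA pq mulmx1.
by rewrite !det_mulmx mulrAC -det_mulmx pq det1 mul1r.
Qed.

Lemma char_poly_trmx (F : comNzRingType) n (A : 'M[F]_n) :
  char_poly A^T = char_poly A.
Proof.
rewrite /char_poly -[RHS]det_tr; congr (\det _).
by rewrite /char_poly_mx raddfB /= tr_scalar_mx map_trmx.
Qed.

(** The complex roots determine the characteristic polynomial because it is
    monic, and the embedding of the reals into the complex numbers is
    injective on polynomials. *)
Lemma spec_eqP (R : realType) n (A B : 'M[R]_n) :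
  spec A = spec B <-> char_poly A = char_poly B.
Proof.
split=> [|eqAB]; last first.
  by rewrite /spec -!map_char_poly /= eqAB.
rewrite /spec; move: (closed_field_poly_normal _) => [r /= rE].
move: (closed_field_poly_normal _) => [s /= sE] /eq_seq_msetP rs.
apply: (@map_poly_inj _ _ (real_complex R)).
rewrite !map_char_poly /= rE sE.
by rewrite !(monicP (char_poly_monic _)) (perm_big _ rs).
Qed.

Lemma trig_mxM (F : nzRingType) n (T S : 'M[F]_n) :
  is_trig_mx T -> is_trig_mx S ->
  is_trig_mx (T *m S) /\ forall i, (T *m S) i i = T i i * S i i.
Proof.
move=> /is_trig_mxP Tt /is_trig_mxP St; split.
  apply/is_trig_mxP => i j ij; rewrite mxE big1 // => k _.
  have [ik|ki] := ltnP i k; first by rewrite Tt // mul0r.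
  by rewrite St ?mulr0 // (leq_ltn_trans ki).
move=> i; rewrite mxE (bigD1 i) //= big1 ?addr0 // => k nki.
have := nki; rewrite neq_ltn => /orP[ki|ik]; last by rewrite Tt // mul0r.
by rewrite St // mulr0.
Qed.

Lemma trig_mxX (F : nzRingType) n (T : 'M[F]_n) k : is_trig_mx T ->
  is_trig_mx (T ^+ k) /\ forall i, (T ^+ k) i i = T i i ^+ k.
Proof.
move=> Tt; elim: k => [|k [IHt IHd]].
  split; first by rewrite expr0; apply: scalar_mx_is_trig.
  by move=> i; rewrite !expr0 mxE eqxx.
have [t d] := trig_mxM Tt IHt.
by rewrite exprS -mulmxE; split=> // i; rewrite d IHd exprS.
Qed.

Lemma conj_mxX (F : comUnitRingType) n (P A : 'M[F]_n) k : P \in unitmx ->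
  (P *m A *m invmx P) ^+ k = P *m A ^+ k *m invmx P.
Proof.
move=> Pu; elim: k => [|k IHk]; first by rewrite !expr0 mulmx1 mulmxV.
by rewrite !exprS IHk -!mulmxE !mulmxA mulmxKV.
Qed.

Lemma mxtrace_conj (F : comUnitRingType) n (P A : 'M[F]_n) : P \in unitmx ->
  \tr (P *m A *m invmx P) = \tr A.
Proof. by move=> Pu; rewrite mxtrace_mulC mulKmx. Qed.

(** A unitary change of basis makes A triangular; the eigenvalues are then the
    diagonal entries, and the diagonal of a power of a triangular matrix
    consists of the powers of its diagonal entries. *)
Lemma char_poly_mxtraceX (C : numClosedFieldType) n (A : 'M[C]_n) :
  exists2 r : seq C, char_poly A = \prod_(z <- r) ('X - z%:P) &
    forall k, \tr (A ^+ k) = \sum_(z <- r) z ^+ k.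
Proof.
case: n A => [|n] A.
  exists [::]; first by rewrite big_nil /char_poly det_mx00.
  by move=> k; rewrite big_nil /mxtrace big_ord0.
have [//|P /unitarymx_unit Pu] := Schur A.
rewrite /similar_to /= conjumx // => Tt.
exists [seq (P *m A *m invmx P) i i | i : 'I_n.+1].
  by rewrite -(char_poly_conj A Pu) char_poly_trig // big_image.
move=> k; rewrite -(mxtrace_conj _ Pu) -conj_mxX // big_image /=.
by apply: eq_bigr => i _; rewrite (trig_mxX k Tt).2.
Qed.

Lemma char_poly_eq_mxtraceX (R : rcfType) n (A B : 'M[R]_n) k :
  char_poly A = char_poly B -> \tr (A ^+ k) = \tr (B ^+ k).
Proof.
move=> eqAB.
have mapX (X : 'M[R]_n) : (\tr (X ^+ k))%:C%C =
    \tr (map_mx (real_complex R) X ^+ k).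
  rewrite -[LHS]/(real_complex R _) -trace_map_mx; congr (\tr _).
  elim: k => [|j IHj]; first by rewrite !expr0 map_mx1.
  by rewrite !exprS -IHj -!mulmxE map_mxM.
have [r rE trA] := char_poly_mxtraceX (map_mx (real_complex R) A).
have [s sE trB] := char_poly_mxtraceX (map_mx (real_complex R) B).
apply: (@complexI R); rewrite !mapX trA trB.
apply: perm_big; apply: prod_XsubC_eq.
by rewrite -rE -sE -!map_char_poly /= eqAB.
Qed.

(** * From traces of powers to Jordan morphisms *)

Lemma mxtrace_mul_delta (F : nzRingType) n (X : 'M[F]_n) i j :
  \tr (X *m delta_mx i j) = X j i.
Proof.
rewrite /mxtrace (bigD1 j) //= big1 => [|k /negPf nkj]; rewrite ?addr0.
  rewrite mxE (bigD1 i) //= big1 => [|k /negPf nki]; rewrite ?addr0 mxE.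
    by rewrite !eqxx mulr1.
  by rewrite nki mulr0.
by rewrite mxE big1 // => l _; rewrite mxE nkj andbF mulr0.
Qed.

Lemma mxtrace_nondegenerate (F : nzRingType) n (X : 'M[F]_n) :
  (forall B, \tr (X *m B) = 0) -> X = 0.
Proof.
move=> trX0; apply/matrixP=> i j.
by rewrite -[LHS](mxtrace_mul_delta X j i) trX0 mxE.
Qed.

(** Finite dimension, through the matrix of psi on vectorized matrices. *)
Lemma injective_mx_surjective (F : fieldType) n
    (psi : {linear 'M[F]_n -> 'M[F]_n}) :
  injective psi -> forall B, exists A, psi A = B.
Proof.
move=> inj_psi B.
have Lu : lin_mx psi \in unitmx.
  rewrite -row_free_unit; apply: inj_row_free => v.
  rewrite mul_rV_lin => /(congr1 vec_mx); rewrite mxvecK linear0 => /eqP.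
  rewrite -(raddf0 psi) => /eqP /inj_psi /(congr1 mxvec).
  by rewrite vec_mxK linear0.
exists (vec_mx (mxvec B *m invmx (lin_mx psi))).
by rewrite -mx_rV_lin mulmxKV // mxvecK.
Qed.

Lemma mxtrace_sqrD (F : comNzRingType) n (A B : 'M[F]_n) :
  \tr ((A + B) ^+ 2) = \tr (A ^+ 2) + \tr (A *m B) *+ 2 + \tr (B ^+ 2).
Proof.
rewrite !expr2 mulrDl !mulrDr !raddfD /= -!mulmxE (mxtrace_mulC B A) mulr2n.
by rewrite !addrA.
Qed.

Lemma mxtrace_cubeD (F : comNzRingType) n (A B : 'M[F]_n) :
  \tr ((A + B) ^+ 3) = \tr (A ^+ 3) + \tr (A ^+ 2 *m B) *+ 3
      + \tr (A *m B ^+ 2) *+ 3 + \tr (B ^+ 3).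
Proof.
have E X Y : \tr (X * (Y * X)) = \tr (X * (X * Y)) :> F.
  by rewrite mulrA -mulmxE mxtrace_mulC.
have E' X Y : \tr (Y * (X * X)) = \tr (X * (X * Y)) :> F.
  by rewrite -mulmxE mxtrace_mulC mulmxA.
rewrite !mulmxE !exprS !expr0 !mulr1 !mulrDl !mulrDr !raddfD /=.
rewrite !E !E' -!mulrA; ring.
Qed.

Section TracePowers.
Variables (F : numFieldType) (n : nat) (psi : {linear 'M[F]_n -> 'M[F]_n}).
Hypothesis tr2 : forall A, \tr (psi A ^+ 2) = \tr (A ^+ 2).

Lemma mxtrace_mul_preserved A B : \tr (psi A *m psi B) = \tr (A *m B).
Proof.
have := tr2 (A + B); rewrite raddfD /= !mxtrace_sqrD !tr2.
by move=> /addIr/addrI/(pmulrnI (n := 2) isT).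
Qed.

Lemma trace_preserver_inj : injective psi.
Proof.
move=> A B eqAB; apply/eqP; rewrite -subr_eq0; apply/eqP.
apply: mxtrace_nondegenerate => C.
by rewrite -mxtrace_mul_preserved raddfB /= eqAB subrr mul0mx raddf0.
Qed.

Hypothesis tr3 : forall A, \tr (psi A ^+ 3) = \tr (A ^+ 3).

(** The part of tr ((A + B)^3) which is odd in B is 3 tr (A^2 B) + tr (B^3). *)
Lemma mxtrace_sqr_mul_preserved A B :
  \tr (psi A ^+ 2 *m psi B) = \tr (A ^+ 2 *m B).
Proof.
have key C : \tr (psi A ^+ 2 *m psi C) *+ 3 + \tr (psi A *m psi C ^+ 2) *+ 3
    = \tr (A ^+ 2 *m C) *+ 3 + \tr (A *m C ^+ 2) *+ 3.
  have := tr3 (A + C); rewrite raddfD /= !mxtrace_cubeD !tr3.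
  by move/addIr; rewrite -!addrA => /addrI.
have keyN := key (- B); have {key} := key B.
rewrite raddfN /= !mulmxN !raddfN /= in keyN.
rewrite [(- B) ^+ 2]sqrrN [(- psi B) ^+ 2]sqrrN in keyN => keyP.
apply: (pmulrnI (n := 6) isT).
have double (x y : F) : x *+ 6 = (x *+ 3 + y) - (- x *+ 3 + y) by ring.
by rewrite /= (double _ (\tr (psi A *m psi B ^+ 2) *+ 3)) keyN keyP -double.
Qed.

(** Both tr (psi (A^2) psi B) and tr ((psi A)^2 psi B) equal tr (A^2 B), and
    psi B is an arbitrary matrix. *)
Lemma trace_preserver_sqr A : psi (A ^+ 2) = psi A ^+ 2.
Proof.
apply/eqP; rewrite -subr_eq0; apply/eqP; apply: mxtrace_nondegenerate => C.
have [B <-] := injective_mx_surjective trace_preserver_inj C.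
rewrite mulmxBl raddfB /= mxtrace_mul_preserved mxtrace_sqr_mul_preserved.
by rewrite subrr.
Qed.

End TracePowers.

(** * Jordan automorphisms of the matrix algebra *)

Section JordanMorphism.
Variables (F : numFieldType) (n : nat) (psi : {linear 'M[F]_n -> 'M[F]_n}).
Hypothesis psi_sqr : forall A, psi (A ^+ 2) = psi A ^+ 2.

Lemma jordanM A B : psi (A * B + B * A) = psi A * psi B + psi B * psi A.
Proof.
have sqrD (X Y : 'M[F]_n) : X * Y + Y * X = (X + Y) ^+ 2 - X ^+ 2 - Y ^+ 2.
  rewrite !expr2 mulrDl !mulrDr addrAC addrA addrK.
  by rewrite -!addrA addrC addrA addrNK.
by rewrite !sqrD !raddfB /= !psi_sqr raddfD.
Qed.

Hypothesis psi_inj : injective psi.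

Let E i j : 'M[F]_n := delta_mx i j.

Lemma E_mul i j k l : E i j * E k l = E i l *+ (j == k).
Proof. exact: mul_delta_mx_cond. Qed.

Lemma jordan_idem i : psi (E i i) * psi (E i i) = psi (E i i).
Proof. by rewrite -expr2 -psi_sqr expr2 E_mul eqxx. Qed.

(** If e and f are idempotents with e f + f e = 0, then multiplying by e on
    either side gives e f = - e f e = f e, so that 2 e f = 0. *)
Lemma jordan_idem_ortho i j : i != j -> psi (E i i) * psi (E j j) = 0.
Proof.
move=> nij; set e := psi (E i i); set f := psi (E j j).
have ef0 : e * f + f * e = 0.
  by rewrite -jordanM !E_mul [j == i]eq_sym (negPf nij) addr0 raddf0.
have ee : e * e = e by apply: jordan_idem.
have /eqP := congr1 (fun x => e * x) ef0.
rewrite mulr0 mulrDr !mulrA ee addr_eq0 => /eqP l.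
have /eqP := congr1 (fun x => x * e) ef0.
rewrite mul0r mulrDl -!mulrA ee mulrA addrC addr_eq0 -l => /eqP r.
by move/eqP: ef0; rewrite r -mulr2n -scaler_nat scaler_eq0 pnatr_eq0 /= => /eqP.
Qed.

(** The images of the diagonal matrix units are nonzero orthogonal idempotents,
    as many as the size; nonzero vectors fixed by each of them form a basis. *)
Lemma jordan_idem_simultaneous :
  exists2 U : 'M[F]_n, U \in unitmx &
    forall i, psi (E i i) *m U = U *m E i i.
Proof.
have /fin_all_exists [u uP] i :
    exists u : 'cV[F]_n, u != 0 /\ psi (E i i) *m u = u.
  have : psi (E i i) != 0.
    rewrite raddf_eq0 //; apply/eqP=> /matrixP/(_ i i).
    by rewrite !mxE !eqxx => /eqP; rewrite oner_eq0.
  have [[l nz] _|] := altP (@existsP _ (fun l => col l (psi (E i i)) != 0)).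
    exists (col l (psi (E i i))); split=> //.
    by rewrite colE mulmxA mulmxE jordan_idem.
  rewrite negb_exists => /forallP col0 /eqP []; apply/matrixP => k l.
  by move: (col0 l); rewrite negbK => /eqP/colP/(_ k); rewrite !mxE.
pose U := \matrix_(r, c) u c r 0.
have colU c : U *m delta_mx c 0 = u c.
  by rewrite -colE; apply/colP=> r; rewrite !mxE.
have eU i : psi (E i i) *m U = U *m E i i.
  apply/matrixP=> r c.
  suff /colP/(_ r) : col c (psi (E i i) *m U) = col c (U *m E i i).
    by rewrite !mxE.
  rewrite !colE -!mulmxA colU mul_delta_mx_cond.
  have [->|nic] := eqVneq i c; first by rewrite mulr1n colU (uP c).2.
  by rewrite -(uP c).2 mulmxA mulmxE jordan_idem_ortho // mul0mx mulr0n mulmx0.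
exists U => //; rewrite -unitmx_tr -row_free_unit; apply: inj_row_free => v.
move=> /(congr1 trmx); rewrite trmx_mul trmxK trmx0 => Uv0.
apply/rowP => i; rewrite mxE.
have : psi (E i i) *m (U *m v^T) = v 0 i *: u i.
  rewrite mulmxA eU -mulmxA.
  have -> : E i i *m v^T = v 0 i *: delta_mx i 0.
    apply/colP=> k; rewrite !mxE (bigD1 i) //= big1 => [|l /negPf nli].
      by rewrite !mxE !eqxx addr0 mulrC andbT.
    by rewrite !mxE nli andbF mul0r.
  by rewrite -scalemxAr colU.
rewrite Uv0 mulmx0 => /esym/eqP.
by rewrite scaler_eq0 (negPf (uP i).1) orbF => /eqP.
Qed.

Section DiagonalFixed.
Hypothesis psi_diag : forall i, psi (E i i) = E i i.

Let a i j := psi (E i j) i j.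
Let b i j := psi (E i j) j i.

Lemma mul_diag_unitE (N : 'M[F]_n) i k l :
  (E i i * N + N * E i i) k l = N k l *+ ((k == i) + (l == i)).
Proof.
rewrite !mxE mulrnDr; congr (_ + _).
  rewrite (bigD1 i) //= big1 => [|m /negPf nmi]; last first.
    by rewrite !mxE nmi andbF mul0r.
  by rewrite !mxE eqxx andbT addr0 mulr_natl; case: eqVneq => [->|].
rewrite (bigD1 i) //= big1 => [|m /negPf nmi]; last by rewrite !mxE nmi mulr0.
by rewrite !mxE eqxx addr0 mulr_natr; case: eqVneq => [->|].
Qed.

(** E_ij satisfies E_ii N + N E_ii = N and E_jj N + N E_jj = N, relations kept
    by psi, and the matrices N satisfying both are supported on the positions
    (i, j) and (j, i). *)
Lemma jordan_off_diag i j : i != j ->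
  psi (E i j) = a i j *: E i j + b i j *: E j i.
Proof.
move=> nij; have nji : j != i by rewrite eq_sym.
have Pi : E i i * psi (E i j) + psi (E i j) * E i i = psi (E i j).
  by rewrite -{1 2}psi_diag -jordanM !E_mul eqxx (negPf nji) addr0.
have Pj : E j j * psi (E i j) + psi (E i j) * E j j = psi (E i j).
  by rewrite -{1 2}psi_diag -jordanM !E_mul eqxx (negPf nji) add0r.
have zero (x : F) m : (m != 1)%N -> x *+ m = x -> x = 0.
  case: m => [|[//|m]] _ // /eqP.
  by rewrite mulrSr -subr_eq0 addrK mulrn_eq0 => /eqP.
apply/matrixP=> k l; move/matrixP/(_ k l): Pi; move/matrixP/(_ k l): Pj.
rewrite !mul_diag_unitE !mxE /a /b.
have [->|nki] := eqVneq k i; have [->|nli] := eqVneq l i;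
  rewrite ?eqxx ?(negPf nij) ?(negPf nji) ?(negPf nki) ?(negPf nli) /=.
- by move=> _ /zero ->; rewrite // !mulr0 addr0.
- have [->|nlj] := eqVneq l j; first by rewrite mulr1 mulr0 addr0.
  by move=> /zero ->; rewrite // !mulr0 addr0.
- have [->|nlj] := eqVneq k j; first by rewrite mulr1 mulr0 add0r.
  by move=> /zero ->; rewrite // !mulr0 addr0.
- by move=> _ /zero ->; rewrite // !mulr0 ?andbF !mulr0 addr0.
Qed.

(** The square of E_ij is zero. *)
Lemma jordan_excl i j : i != j -> a i j * b i j = 0.
Proof.
move=> nij; have nji : j != i by rewrite eq_sym.
have : psi (E i j) * psi (E i j) = 0.
  by rewrite -expr2 -psi_sqr expr2 E_mul (negPf nji) raddf0.
rewrite jordan_off_diag // -!mulmxE mulmxDl !mulmxDr -!scalemxAl -!scalemxAr.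
rewrite !mulmxE !E_mul !eqxx (negPf nji) (negPf nij) !scaler0 addr0 add0r.
by move=> /matrixP/(_ i i); rewrite !mxE !eqxx (negPf nij) !mulr0 addr0 mulr1.
Qed.

(** E_ij E_ji + E_ji E_ij = E_ii + E_jj, read at position (i, i). *)
Lemma jordan_inv i j : i != j -> a i j * a j i + b i j * b j i = 1.
Proof.
move=> nij; have nji : j != i by rewrite eq_sym.
have := jordanM (E i j) (E j i).
rewrite !E_mul !eqxx !mulr1n raddfD /= !psi_diag !jordan_off_diag // -!mulmxE.
rewrite !mulmxDl !mulmxDr -!scalemxAl -!scalemxAr.
rewrite !mulmxE !E_mul !eqxx (negPf nji) (negPf nij) !scaler0 !addr0 !add0r.
move=> /matrixP/(_ i i); rewrite !mxE !eqxx (negPf nij) /=.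
by rewrite !mulr0 !addr0 !mulr1 !add0r [b j i * _]mulrC => <-.
Qed.

(** E_ij E_jk + E_jk E_ij = E_ik for distinct i, j and k. *)
Lemma jordan_trans i j k : i != j -> j != k -> i != k ->
  a i k = a i j * a j k /\ b i k = b i j * b j k.
Proof.
move=> nij njk nik.
have nji : j != i by rewrite eq_sym.
have nkj : k != j by rewrite eq_sym.
have nki : k != i by rewrite eq_sym.
have := jordanM (E i j) (E j k).
rewrite !E_mul !eqxx (negPf nki) addr0.
rewrite !(jordan_off_diag nij) !(jordan_off_diag njk) !(jordan_off_diag nik).
rewrite -!mulmxE.
rewrite !mulmxDl !mulmxDr -!scalemxAl -!scalemxAr.
rewrite !mulmxE !E_mul !eqxx (negPf nji) (negPf nij) (negPf nik) (negPf nki).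
rewrite (negPf njk) (negPf nkj) !scaler0 !addr0 !add0r.
move=> H; split.
  move/matrixP/(_ i k): H; rewrite !mxE !eqxx (negPf nik) /=.
  by rewrite !mulr0 !addr0 !mulr1.
move/matrixP/(_ k i): H; rewrite !mxE !eqxx (negPf nki) /=.
by rewrite !mulr0 !add0r !mulr1 [b j k * _]mulrC.
Qed.

(** By [jordan_excl] and [jordan_inv] each pair (i, j) is either direct,
    psi E_ij being a nonzero multiple of E_ij, or reversed.  A direct pair
    makes (j, i) direct by [jordan_inv] and (j, k) direct by [jordan_trans]:
    if (j, k) were reversed, then both coefficients of psi E_ik would
    vanish.  These moves connect all pairs of distinct indices. *)
Lemma jordan_same_type i j k l : i != j -> k != l -> a i j != 0 -> b k l = 0.
Proof.
have type i' j' : i' != j' -> (b i' j' == 0) = (a i' j' != 0).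
  move=> nij; have := jordan_inv nij; have /eqP := jordan_excl nij.
  rewrite mulf_eq0 => /orP[]/eqP ->; rewrite ?eqxx mul0r ?(add0r, addr0).
    by case: eqP => //= -> /eqP; rewrite mul0r eq_sym oner_eq0.
  by case: eqP => //= -> /eqP; rewrite mul0r eq_sym oner_eq0.
pose t i' j' := a i' j' != 0.
have t_sym i' j' : i' != j' -> t i' j' -> t j' i'.
  move=> nij tij; have := jordan_inv nij.
  move: tij; rewrite /t -type // => /eqP ->.
  rewrite mul0r addr0; case: (a j' i' =P 0) => // -> /eqP.
  by rewrite mulr0 eq_sym oner_eq0.
have t_trans i' j' k' : i' != j' -> j' != k' -> i' != k' -> t i' j' -> t j' k'.
  move=> nij njk nik; have [aE bE] := jordan_trans nij njk nik.
  rewrite /t; apply: contra_neq => ajk0; have := type _ _ nik.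
  rewrite aE ajk0 mulr0 eqxx bE mulf_eq0 => /negbT; rewrite negb_or => /andP[].
  by rewrite type // negbK => /eqP.
move=> nij nkl tij; apply/eqP; rewrite type //.
move: tij; rewrite -!/(t _ _) => tij.
have nji : j != i by rewrite eq_sym.
have tji := t_sym _ _ nij tij.
have [ki|nki] := eqVneq k i.
  have [->|nlj] := eqVneq l j; first by rewrite ki.
  by rewrite ki; apply: (t_trans j) => //; [rewrite -ki | rewrite eq_sym].
have [kj|nkj] := eqVneq k j.
  have [->|nli] := eqVneq l i; first by rewrite kj.
  by rewrite kj; apply: (t_trans i) => //; [rewrite -kj | rewrite eq_sym].
have njk : j != k by rewrite eq_sym.
have nik : i != k by rewrite eq_sym.
have tjk : t j k by apply: (t_trans i).
have [->|nlj] := eqVneq l j; first exact: t_sym.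
by apply: (t_trans j) => //; rewrite eq_sym.
Qed.

(** The coefficients satisfy a_ij = a_io a_oj and a_io a_oi = 1, so that psi is
    the conjugation by the diagonal matrix with entries a_io. *)
Lemma jordan_units_scaled (o : 'I_n) : (forall i j, i != j -> b i j = 0) ->
  exists2 D : 'M[F]_n, D \in unitmx & forall A, psi A *m D = D *m A.
Proof.
move=> b0.
have a1 i : a i i = 1 by rewrite /a psi_diag mxE !eqxx.
have aV i : a i o * a o i = 1.
  have [->|nio] := eqVneq i o; first by rewrite a1 mulr1.
  by rewrite -(jordan_inv nio) b0 // mul0r addr0.
have aE i j : a i j = a i o * a o j.
  have [->|nij] := eqVneq i j; first by rewrite a1 aV.
  have [->|nio] := eqVneq i o; first by rewrite a1 mul1r.
  have [->|njo] := eqVneq o j; first by rewrite a1 mulr1.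
  by case: (jordan_trans nio njo nij).
exists (diag_mx (\row_i a i o)) => [|A].
  rewrite unitmxE det_diag unitfE; apply/prodf_neq0 => i _; rewrite mxE.
  by apply/eqP=> ai0; move/eqP: (aV i); rewrite ai0 mul0r eq_sym oner_eq0.
have psiE i j : psi (E i j) = a i j *: E i j.
  have [->|nij] := eqVneq i j; first by rewrite psi_diag a1 scale1r.
  by rewrite jordan_off_diag // b0 // scale0r addr0.
rewrite [A]matrix_sum_delta raddf_sum mulmx_suml mulmx_sumr /=.
apply: eq_bigr => i _; rewrite raddf_sum mulmx_suml mulmx_sumr /=.
apply: eq_bigr => j _; rewrite linearZ /= -!scalemxAr -scalemxAl psiE.
congr (_ *: _); apply/matrixP=> k l.
rewrite -scalemxAl mul_mx_diag mul_diag_mx !mxE.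
have [->|] := eqVneq k i; last by rewrite mul0r !mulr0.
have [->|] := eqVneq l j; last by rewrite mul0r !mulr0.
by rewrite mulr1 mul1r aE -mulrA [a o j * _]mulrC aV mulr1.
Qed.

End DiagonalFixed.
End JordanMorphism.

(** After a conjugation the diagonal matrix units are fixed; according to the
    common type of the pairs (i, j), the map or its composition with the
    transposition is then a diagonal conjugation. *)
Lemma jordan_inner_or_trans (F : numFieldType) n
    (psi : {linear 'M[F]_n -> 'M[F]_n}) :
    (forall A, psi (A ^+ 2) = psi A ^+ 2) -> injective psi ->
  exists2 P : 'M[F]_n, P \in unitmx &
    (forall A, psi A = P *m A *m invmx P) \/
    (forall A, psi A = P *m A^T *m invmx P).
Proof.
move=> psi_sqr psi_inj.
have [U Uu UE] := jordan_idem_simultaneous psi_sqr psi_inj.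
pose theta : {linear 'M[F]_n -> 'M[F]_n} :=
  (mulmxr U \o (mulmx (invmx U) \o psi)).
have thetaE A : theta A = invmx U *m psi A *m U by [].
have psiE A : psi A = U *m theta A *m invmx U.
  by rewrite thetaE !mulmxA mulmxV // mul1mx mulmxK.
have theta_sqr A : theta (A ^+ 2) = theta A ^+ 2.
  by rewrite !thetaE psi_sqr !expr2 -!mulmxE !mulmxA mulmxK.
have theta_diag i : theta (delta_mx i i) = delta_mx i i.
  by rewrite thetaE -mulmxA UE mulKmx.
have conj (th : {linear 'M[F]_n -> 'M[F]_n}) (D : 'M[F]_n) : D \in unitmx ->
    (forall A, th A *m D = D *m A) -> forall A,
    U *m th A *m invmx U = (U *m D) *m A *m invmx (U *m D).
  move=> Du thD A; have UDu : U *m D \in unitmx by rewrite unitmx_mul Uu.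
  apply: (canRL (mulmxK UDu)).
  by rewrite mulmxA mulmxKV // -!mulmxA thD.
case: (pickP (fun o : 'I_n => true)) => [o _|no]; last first.
  (* The matrices of size 0 are all equal. *)
  exists 1%:M; rewrite ?unitmx1 //; left=> A.
  by apply/matrixP=> i; have := no i.
case: (boolP [forall i, forall j,
               (i != j) ==> (theta (delta_mx i j) j i == 0)]).
  move=> /forallP b0.
  have [i j nij|D Du thD] := jordan_units_scaled theta_sqr theta_diag o.
    by move: (b0 i) => /forallP/(_ j)/implyP/(_ nij)/eqP.
  exists (U *m D); first by rewrite unitmx_mul Uu.
  by left=> A; rewrite psiE; apply: conj.
rewrite negb_forall => /existsP[k]; rewrite negb_forall => /existsP[l].
rewrite negb_imply => /andP[nkl bkl].
pose thetaT : {linear 'M[F]_n -> 'M[F]_n} := (theta \o trmx).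
have thetaTE A : thetaT A = theta A^T by [].
have thetaT_sqr A : thetaT (A ^+ 2) = thetaT A ^+ 2.
  by rewrite !thetaTE -theta_sqr !expr2 -!mulmxE trmx_mul.
have thetaT_diag i : thetaT (delta_mx i i) = delta_mx i i.
  by rewrite thetaTE trmx_delta.
have [i j nij|D Du thD] := jordan_units_scaled thetaT_sqr thetaT_diag o.
  rewrite thetaTE trmx_delta; apply/eqP; apply: contraNT bkl => aji.
  apply/eqP; apply: (jordan_same_type theta_sqr theta_diag _ _ aji) => //.
  by rewrite eq_sym.
exists (U *m D); first by rewrite unitmx_mul Uu.
right=> A; rewrite psiE -[A in theta A]trmxK; exact: (conj thetaT).
Qed.

(** * Spectrum preservers of block diagonal matrices *)

Lemma exists_nonroot (F : numFieldType) (p : {poly F}) : p != 0 ->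
  exists2 x, x != 0 & ~~ root p x.
Proof.
move=> p0.
(* The factor 'X excludes 0 from the nonroots. *)
pose q := p * 'X.
have q0 : q != 0 by rewrite mulf_neq0 // polyX_eq0.
pose rs := [seq k%:R : F | k <- iota 0 (size q)].
have urs : uniq rs.
  by rewrite map_inj_uniq ?iota_uniq //; apply: mulrIn; rewrite oner_eq0.
have /allPn[x _] : ~~ all (root q) rs.
  apply/negP=> /(max_poly_roots q0)/(_ urs).
  by rewrite size_map size_iota ltnn.
by rewrite rootM rootX negb_or => /andP[px x0]; exists x.
Qed.

Lemma char_poly_neq0 (F : idomainType) n (A : 'M[F]_n) : char_poly A != 0.
Proof. exact/monic_neq0/char_poly_monic. Qed.

(** The translation by 1 modulo m. *)
Lemma exists_derangement m : (1 < m)%N -> exists s : 'S_m, forall i, s i != i.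
Proof.
case: m => [|[|k]] // _.
exists (perm (addrI (1 : 'I_k.+2))) => i.
by rewrite permE -subr_eq0 addrK oner_eq0.
Qed.

Section BlockDiagonal.
Variables (R : nzRingType) (m : nat).

Definition diag_block (c : R) (B : 'M[R]_m) : 'M[R]_(1 + m) :=
  block_mx c%:M 0 0 B.

Lemma diag_blockM c d B C :
  diag_block c B *m diag_block d C = diag_block (c * d) (B *m C).
Proof.
by rewrite /diag_block mulmx_block !mul0mx !mulmx0 !addr0 add0r scalar_mxM.
Qed.

Lemma diag_block_linear a c d B C :
  diag_block (a * c + d) (a *: B + C) = a *: diag_block c B + diag_block d C.
Proof.
rewrite /diag_block scale_block_mx add_block_mx scale_scalar_mx raddfD /=.
by rewrite !scaler0 !addr0.
Qed.

Lemma diag_block0_linear : linear (diag_block 0).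
Proof. by move=> a B C; rewrite -diag_block_linear mulr0 addr0. Qed.

HB.instance Definition _ :=
  GRing.isLinear.Build R 'M[R]_m 'M[R]_(1 + m) _ (diag_block 0)
    diag_block0_linear.

End BlockDiagonal.

Lemma char_poly_diag_block (R : comNzRingType) m c (B : 'M[R]_m) :
  char_poly (diag_block c B) = ('X - c%:P) * char_poly B.
Proof.
rewrite /char_poly /diag_block char_block_diag_mx det_ublock; congr (_ * _).
by rewrite [char_poly_mx _]mx11_scalar det_scalar1 !mxE eqxx.
Qed.

Section BlockPreserver.
Variables (F : rcfType) (m : nat).
Variable Psi : {linear 'M[F]_(1 + m) -> 'M[F]_(1 + m)}.
Hypothesis Psi_block : forall c B, exists d C,
  Psi (diag_block c B) = diag_block d C.
Hypothesis Psi_char : forall c B,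
  char_poly (Psi (diag_block c B)) = char_poly (diag_block c B).
Hypothesis m_gt1 : (1 < m)%N.

(* Psi maps the block diagonal matrix with blocks c and B to the one with
   blocks c * corner_scale + corner B and c *: lower_shift + lower B. *)
Let corner_scale := Psi (diag_block 1 0) 0 0.
Let lower_shift := drsubmx (Psi (diag_block 1 0)).
Let corner B := Psi (diag_block 0 B) 0 0.
Let lower : {linear 'M[F]_m -> 'M[F]_m} :=
  (@rsubmx F m 1 m \o @dsubmx F 1 m (1 + m) \o Psi \o diag_block 0).

Lemma diag_block_split (c : F) (B : 'M[F]_m) :
  diag_block c B = c *: diag_block 1 0 + diag_block 0 B.
Proof. by rewrite -diag_block_linear mulr1 scaler0 addr0 add0r. Qed.

Lemma diag_block00 c (B : 'M[F]_m) : diag_block c B 0 0 = c.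
Proof.
by rewrite /diag_block -(lshift0 m 0) block_mxEul mxE eqxx.
Qed.

Lemma Psi_diag_blockE c B :
  Psi (diag_block c B) =
  diag_block (c * corner_scale + corner B) (c *: lower_shift + lower B).
Proof.
have [d [C E]] := Psi_block c B; rewrite E.
have dE : d = c * corner_scale + corner B.
  have := congr1 (fun X : 'M[F]_(1 + m) => X 0 0) E.
  by rewrite /= diag_block00 diag_block_split linearP !mxE.
have CE : C = c *: lower_shift + lower B.
  have := congr1 (@drsubmx _ _ _ _ _) E.
  by rewrite block_mxKdr diag_block_split /drsubmx !linearP => <-.
by rewrite dE CE.
Qed.

Lemma char_poly_factors c B :
  ('X - (c * corner_scale + corner B)%:P)
    * char_poly (c *: lower_shift + lower B) =
  ('X - c%:P) * char_poly B.
Proof. by rewrite -!char_poly_diag_block -Psi_diag_blockE Psi_char. Qed.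

(** The left-hand side of [char_poly_factors] vanishes at the new corner, hence
    so does one of the two factors on the right. *)
Lemma corner_root c B :
  c * corner_scale + corner B = c \/
  root (char_poly B) (c * corner_scale + corner B).
Proof.
have := congr1 (horner^~ (c * corner_scale + corner B)) (char_poly_factors c B).
rewrite !hornerM !hornerXsubC subrr mul0r => /esym/eqP.
by rewrite mulf_eq0 subr_eq0 => /orP[/eqP|] ?; [left | right].
Qed.

(** With c = 0 the corner of N is an eigenvalue of N, hence 0. *)
Lemma corner_square_zero N : N *m N = 0 -> corner N = 0.
Proof.
move=> NN; have := corner_root 0 N; rewrite mul0r add0r => -[//|].
rewrite -eigenvalue_root_char => /eigenvalueP[v vN v0].
have : v *m N *m N = 0 by rewrite -mulmxA NN mulmx0.
rewrite vN -scalemxAl vN scalerA => /eqP.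
by rewrite scaler_eq0 (negPf v0) orbF mulf_eq0 orbb => /eqP.
Qed.

(** The permutation matrix of a derangement is a sum of square-zero matrix
    units, so that the corner does not see that it is invertible. *)
Lemma exists_unit_corner0 : exists2 B : 'M[F]_m, corner B = 0 & B \in unitmx.
Proof.
have [s s_der] := exists_derangement m_gt1.
exists (perm_mx s); last exact: unitmx_perm.
rewrite [perm_mx s]matrix_sum_delta /corner !raddf_sum summxE big1 //= => i _.
rewrite !raddf_sum summxE big1 //= => j _; rewrite !linearZ !mxE /=.
have [<-|] := eqVneq (s i) j; last by rewrite mul0r.
by rewrite mul1r; apply: corner_square_zero; rewrite mul_delta_mx_0.
Qed.

(** For B invertible with zero corner, c * corner_scale is c or an eigenvalue of
    B.  The latter fails for all but finitely many c, because 0 is not an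
    eigenvalue of B. *)
Lemma corner_scale_eq1 : corner_scale = 1.
Proof.
have [B cornerB Bu] := exists_unit_corner0.
pose p := char_poly B \Po (corner_scale *: 'X).
have /exists_nonroot[c c0] : p != 0.
  apply/eqP=> /(congr1 (horner^~ 0)).
  rewrite horner_comp !hornerE ?mulr0 horner_coef0 char_poly_det => /eqP.
  by rewrite mulf_eq0 signr_eq0; move: Bu; rewrite unitmxE unitfE => /negPf ->.
rewrite root_comp !hornerE => /negP pc.
have := corner_root c B.
rewrite cornerB addr0 [c * corner_scale]mulrC => -[|//].
by rewrite -[RHS]mul1r => /(mulIf c0).
Qed.

(** For all but finitely many c, the scalar c + corner B is not an eigenvalue of
    B and hence equals c. *)
Lemma corner0 B : corner B = 0.
Proof.
pose p := char_poly B \Po ('X + (corner B)%:P).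
have /exists_nonroot[c c0] : p != 0.
  by rewrite comp_poly2_eq0 ?char_poly_neq0 // size_XaddC.
rewrite root_comp !hornerE => /negP pc.
have := corner_root c B; rewrite corner_scale_eq1 mulr1 => -[|//].
by rewrite -[RHS]addr0 => /addrI.
Qed.

Lemma char_poly_lower c B :
  char_poly (c *: lower_shift + lower B) = char_poly B.
Proof.
have := char_poly_factors c B; rewrite corner_scale_eq1 mulr1 corner0 addr0.
by apply: mulfI; rewrite polyXsubC_eq0.
Qed.

Lemma shifted_mxtraceX c B k :
  \tr ((c *: lower_shift + lower B) ^+ k) = \tr (B ^+ k).
Proof. exact/char_poly_eq_mxtraceX/char_poly_lower. Qed.

Lemma lower_mxtraceX B k : \tr (lower B ^+ k) = \tr (B ^+ k).
Proof. by rewrite -(shifted_mxtraceX 0 B) scale0r add0r. Qed.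

(** With K the lower shift, the traces of (K + lower B)^2 and of (lower B)^2
    agree.  As tr (K^2) = 0, by the case B = 0, this leaves tr (K lower B) = 0, and lower is onto. *)
Lemma lower_shift0 : lower_shift = 0.
Proof.
have lower_inj : injective lower.
  by apply: trace_preserver_inj => B; apply: lower_mxtraceX.
have tr_shift c B :
  \tr ((c *: lower_shift + lower B) ^+ 2) = \tr (lower B ^+ 2).
  by rewrite shifted_mxtraceX lower_mxtraceX.
have tr_shiftK : \tr (lower_shift ^+ 2) = 0.
  have := tr_shift 1 0; rewrite linear0 addr0 scale1r => ->.
  by rewrite expr2 mul0r linear0.
apply: mxtrace_nondegenerate => C.
have [B <-] := injective_mx_surjective lower_inj C.
have := tr_shift 1 B; rewrite scale1r mxtrace_sqrD tr_shiftK add0r => /eqP.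
by rewrite -subr_eq0 addrK mulrn_eq0 => /eqP.
Qed.

Lemma block_preserver :
  exists2 Q : 'M[F]_m, Q \in unitmx &
    (forall c B, Psi (diag_block c B) = diag_block c (Q *m B *m invmx Q)) \/
    (forall c B, Psi (diag_block c B) = diag_block c (Q *m B^T *m invmx Q)).
Proof.
have PE c B : Psi (diag_block c B) = diag_block c (lower B).
  rewrite Psi_diag_blockE corner_scale_eq1 corner0 lower_shift0.
  by rewrite mulr1 addr0 scaler0 add0r.
have tr2 A : \tr (lower A ^+ 2) = \tr (A ^+ 2) by apply: lower_mxtraceX.
have tr3 A : \tr (lower A ^+ 3) = \tr (A ^+ 3) by apply: lower_mxtraceX.
have [Q Qu QE] :=
  jordan_inner_or_trans (trace_preserver_sqr tr2 tr3) (trace_preserver_inj tr2).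
by exists Q => //; case: QE => QE; [left | right] => c B; rewrite PE QE.
Qed.

End BlockPreserver.

(** * The span of the doubly stochastic matrices *)

Section DsSpan.
Variables (R : realType) (m : nat).
Local Notation n := (1 + m)%N.

Let one_c : 'cV[R]_n := const_mx 1.
Let one_r : 'rV[R]_n := const_mx 1.

Lemma mulmx_ones_row_sum p q (A : 'M[R]_(p, q)) i :
  (A *m (const_mx 1 : 'cV_q)) i 0 = \sum_j A i j.
Proof. by rewrite mxE; apply: eq_bigr => j _; rewrite mxE mulr1. Qed.

Lemma ones_mulmx_col_sum p q (A : 'M[R]_(p, q)) j :
  ((const_mx 1 : 'rV_p) *m A) 0 j = \sum_i A i j.
Proof. by rewrite mxE; apply: eq_bigr => i _; rewrite mxE mul1r. Qed.

Lemma doubly_stochastic_span p (A : 'M[R]_p) :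
  doubly_stochastic A -> A \in ds_span R p.
Proof.
move=> dA; apply/asboolP; exists 1%N, (fun=> 1), (fun=> A).
by split=> //; rewrite big_ord1 scale1r.
Qed.

(** If A has all row and column sums equal to c, then adding a large constant M
    to the entries of A gives a positive multiple of a doubly stochastic matrix,
    and the constant matrix M is itself a multiple of one. *)
Lemma ds_spanP (A : 'M[R]_n) :
  A \in ds_span R n <->
  exists c, A *m one_c = c *: one_c /\ one_r *m A = c *: one_r.
Proof.
split=> [/asboolP[p [a [D [dsD ->]]]]|[c [Ac Ar]]].
  exists (\sum_k a k); rewrite mulmx_suml mulmx_sumr !scaler_suml.
  split; apply: eq_bigr => k _; case: (dsD k) => _ row_D col_D.
    rewrite -scalemxAl; congr (_ *: _); apply/colP => i.
    by rewrite mulmx_ones_row_sum row_D mxE.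
  rewrite -scalemxAr; congr (_ *: _); apply/rowP => j.
  by rewrite ones_mulmx_col_sum col_D mxE.
have rowA i : \sum_j A i j = c by rewrite -mulmx_ones_row_sum Ac !mxE mulr1.
have colA j : \sum_i A i j = c by rewrite -ones_mulmx_col_sum Ar !mxE mulr1.
pose M := 1 + \sum_i \sum_j `|A i j|.
have AM i j : 0 < A i j + M.
  rewrite /M (bigD1 i) //= (bigD1 j) //=.
  have h1 : 0 <= \sum_(j' | j' != j) `|A i j'| by apply: sumr_ge0.
  have h2 : 0 <= \sum_(i' | i' != i) \sum_j' `|A i' j'|.
    by apply: sumr_ge0 => i' _; apply: sumr_ge0.
  have := ler_norm (- A i j); rewrite normrN; lra.
pose t := c + M *+ n.
have sumM : \sum_(i < n) M = M *+ n by rewrite sumr_const card_ord.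
have t_gt0 : 0 < t.
  rewrite /t -(rowA 0) -sumM -big_split /=.
  rewrite big_ord_recl ltr_wpDr ?AM // sumr_ge0 // => i _.
  exact/ltW/AM.
have n0 : (n%:R : R) != 0 by rewrite pnatr_eq0.
have -> : A = t *: (t^-1 *: (A + const_mx M)) - (M *+ n) *: const_mx (n%:R^-1).
  apply/matrixP=> i j; rewrite !mxE mulrA divff ?gt_eqF // mul1r.
  by rewrite -mulr_natr -mulrA divff // mulr1 addrK.
apply: rpredB; apply: rpredZ; apply: doubly_stochastic_span; split.
- by move=> i j; rewrite !mxE mulr_ge0 ?invr_ge0 ?ltW.
- move=> i; under eq_bigr do rewrite !mxE.
  by rewrite -mulr_sumr big_split /= rowA sumM mulVf ?gt_eqF.
- move=> i; under eq_bigr do rewrite !mxE.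
  by rewrite -mulr_sumr big_split /= colA sumM mulVf ?gt_eqF.
- by move=> i j; rewrite !mxE invr_ge0 ler0n.
- move=> i; under eq_bigr do rewrite !mxE.
  by rewrite sumr_const card_ord -[LHS]mulr_natr mulVf.
- move=> i; under eq_bigr do rewrite !mxE.
  by rewrite sumr_const card_ord -[LHS]mulr_natr mulVf.
Qed.

(** The columns are e and the e_j - e_0 with j > 0, a basis of the orthogonal
    complement of e. *)
Definition adapted_basis : 'M[R]_n :=
  block_mx 1%:M (const_mx (-1)) (const_mx 1) 1%:M.
Local Notation S := adapted_basis.

Lemma adapted_basis_unit : S \in unitmx.
Proof.
rewrite -row_free_unit; apply: inj_row_free => v.
rewrite -[v]hsubmxK; move: (lsubmx v) (rsubmx v) => a w.
rewrite /S mul_row_block !mulmx1 -row_mx0 => /eq_row_mx[aw wa].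
have {}wa : w = const_mx (a 0 0).
  apply/rowP=> j; move/matrixP/(_ 0 j): wa; rewrite !mxE big_ord1 !mxE => /eqP.
  by rewrite mulrN1 addrC subr_eq0 => /eqP.
have a0 : a 0 0 = 0.
  move/matrixP/(_ 0 0): aw; rewrite !mxE.
  rewrite (eq_bigr (fun=> a 0 0)) => [|k _]; last by rewrite wa !mxE mulr1.
  rewrite sumr_const card_ord -mulrS => /eqP.
  by rewrite mulrn_eq0 /= => /eqP.
have -> : w = 0 by rewrite wa a0; apply/rowP=> j; rewrite !mxE.
have -> : a = 0 by apply/matrixP=> i j; rewrite !ord1 a0 mxE.
by rewrite row_mx0.
Qed.

Let e0c : 'cV[R]_n := col_mx 1%:M 0.
Let e0r : 'rV[R]_n := row_mx 1%:M 0.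

Lemma adapted_basis_col : S *m e0c = one_c.
Proof.
rewrite /S mul_block_col !mulmx0 !addr0 !mulmx1 /one_c -(col_mx_const 1 m).
by congr (col_mx _ _); apply/matrixP=> i j; rewrite !ord1 !mxE.
Qed.

Lemma adapted_basis_row : one_r *m S = n%:R *: e0r.
Proof.
rewrite /one_r -(@row_mx_const _ 1 1 m 1) mul_row_block !mulmx1.
rewrite scale_row_mx scaler0.
congr (row_mx _ _).
  apply/matrixP=> i j; rewrite !ord1 !mxE /= mulr1.
  under eq_bigr do rewrite !mxE mulr1.
  by rewrite sumr_const card_ord -mulrS.
by apply/rowP=> j; rewrite !mxE big_ord1 !mxE mul1r addNr.
Qed.

Lemma diag_block_e0 (c : R) (B : 'M_m) :
  diag_block c B *m e0c = c *: e0c /\ e0r *m diag_block c B = c *: e0r.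
Proof.
split.
  rewrite /diag_block mul_block_col !mulmx0 !mulmx1 !addr0.
  by rewrite scale_col_mx scaler0 scale_scalar_mx mulr1.
rewrite /diag_block mul_row_block !mul0mx !mul1mx !addr0.
by rewrite scale_row_mx scaler0 scale_scalar_mx mulr1.
Qed.

Lemma row_adapted_basisV : e0r *m invmx S = n%:R^-1 *: one_r.
Proof.
apply: (canLR (mulmxK adapted_basis_unit)).
by rewrite -scalemxAl adapted_basis_row scalerA mulVf ?scale1r ?pnatr_eq0.
Qed.

(** In the adapted basis the conditions A e = c e and e^T A = c e^T say that the
    first column and the first row are c times those of the identity. *)
Lemma diag_block_ds_span c B : S *m diag_block c B *m invmx S \in ds_span R n.
Proof.
have [Bc Br] := diag_block_e0 c B; have Su := adapted_basis_unit.
apply/ds_spanP; exists c; split.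
  rewrite -{1}adapted_basis_col mulmxA mulmxKV // -mulmxA Bc.
  by rewrite -scalemxAr adapted_basis_col.
rewrite !mulmxA adapted_basis_row -!scalemxAl Br -scalemxAl row_adapted_basisV.
by rewrite !scalerA mulrAC divff ?mul1r // pnatr_eq0.
Qed.

Lemma ds_span_diag_block A : A \in ds_span R n ->
  exists c B, A = S *m diag_block c B *m invmx S.
Proof.
have Su := adapted_basis_unit.
case/ds_spanP=> c [Ac Ar]; pose X := invmx S *m A *m S.
have Xc : X *m e0c = c *: e0c.
  rewrite /X -!mulmxA adapted_basis_col Ac -scalemxAr.
  by rewrite -adapted_basis_col mulKmx.
have Xr : e0r *m X = c *: e0r.
  rewrite /X !mulmxA row_adapted_basisV -!scalemxAl Ar -scalemxAl.
  by rewrite adapted_basis_row !scalerA mulrAC mulVf ?mul1r // pnatr_eq0.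
exists c, (drsubmx X).
suff -> : diag_block c (drsubmx X) = X.
  by rewrite /X !mulmxA mulmxV // mul1mx mulmxK.
move: Xc Xr; rewrite -{1 2 4}[X]submxK mul_block_col mul_row_block.
rewrite !mulmx0 !mulmx1 !addr0 !mul0mx !mul1mx !addr0 scale_col_mx scale_row_mx.
rewrite !scaler0 scale_scalar_mx mulr1.
by case/eq_col_mx=> _ -> /eq_row_mx[-> ->].
Qed.

(** The conjugating matrix for the transposed form, where S^T takes the place of
    S^-1: the transpose of S X S^-1 is S^-T X^T S^T, and S^T cancels S^-T. *)
Lemma adapted_conj_ds_span Q :
  S *m diag_block 1 Q *m S^T \in ds_span R n.
Proof.
have [Bc Br] := diag_block_e0 1 Q; rewrite !scale1r in Bc Br.
have e0T : e0c^T = e0r by rewrite tr_col_mx tr_scalar_mx trmx0.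
have oneT : one_c^T = one_r by rewrite trmx_const.
have StC : S^T *m one_c = n%:R *: e0c.
  apply: trmx_inj; rewrite trmx_mul trmxK oneT adapted_basis_row.
  by rewrite linearZ /= e0T.
have StR : e0r *m S^T = one_r.
  by rewrite -e0T -trmx_mul adapted_basis_col oneT.
apply/ds_spanP; exists n%:R; split.
  by rewrite -mulmxA StC -scalemxAr -mulmxA Bc adapted_basis_col.
by rewrite !mulmxA adapted_basis_row -!scalemxAl Br StR.
Qed.

End DsSpan.

(** * Spectrum preservers of the span *)

Section ToDsSpan.
Variables (R : realType) (m : nat).
Local Notation S := (adapted_basis R m).

(** Defined on all matrices, forgetting the two off-diagonal blocks, so that
    composing with it turns phi into a linear map of a full matrix space. *)
Definition dsSpan_of_mx (X : 'M[R]_(1 + m)) : dsSpan R (1 + m) :=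
  DsSpan (diag_block_ds_span (X 0 0) (drsubmx X)).

Lemma dsSpan_of_mx_linear : linear dsSpan_of_mx.
Proof.
move=> a X Y; apply: val_inj; rewrite linearP /=.
rewrite /drsubmx !linearP !mxE diag_block_linear.
by rewrite mulmxDr mulmxDl -scalemxAr -scalemxAl.
Qed.

HB.instance Definition _ :=
  GRing.isLinear.Build R 'M[R]_(1 + m) (dsSpan R (1 + m)) _
    dsSpan_of_mx dsSpan_of_mx_linear.

Lemma dsSpan_of_mx_diag_block (A : dsSpan R (1 + m)) :
  exists c B, A = dsSpan_of_mx (diag_block c B) /\
    A = S *m diag_block c B *m invmx S :> 'M_(1 + m).
Proof.
have [c [B AE]] := ds_span_diag_block (ds_mxP A).
exists c, B; split=> //; apply: val_inj; rewrite /= AE diag_block00.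
by rewrite /diag_block block_mxKdr.
Qed.

End ToDsSpan.

(** [block_preserver] transported through the adapted basis S.  The direct form
    is realized by S diag(1, Q) S^-1, the transposed one by
    S diag(1, Q) S^T. *)
Lemma char_poly_preserver_ge3 (R : realType) (m : nat) (m_gt1 : (1 < m)%N)
    (phi : {linear dsSpan R (1 + m) -> dsSpan R (1 + m)}) :
  (forall A, char_poly (phi A) = char_poly A) ->
  exists P : 'M[R]_(1 + m), [/\ P \in ds_span R (1 + m), P \in unitmx
    & (forall A : dsSpan R (1 + m), phi A = P *m A *m invmx P :> 'M_(1 + m)) \/
      (forall A : dsSpan R (1 + m), phi A = P *m A^T *m invmx P :> 'M_(1 + m))].
Proof.
move=> phi_char; have Su := adapted_basis_unit R m.
pose S := adapted_basis R m.
pose Psi : {linear 'M[R]_(1 + m) -> 'M[R]_(1 + m)} :=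
  (mulmxr S \o (mulmx (invmx S) \o (val \o phi \o @dsSpan_of_mx R m))).
have PsiE X : Psi X = invmx S *m phi (dsSpan_of_mx X) *m S by [].
have phiE X : phi (dsSpan_of_mx X) = S *m Psi X *m invmx S :> 'M_(1 + m).
  by rewrite PsiE !mulmxA mulmxV // mul1mx mulmxK.
have Psi_block c B : exists d C, Psi (diag_block c B) = diag_block d C.
  have [d [C [_ E]]] :=
    dsSpan_of_mx_diag_block (phi (dsSpan_of_mx (diag_block c B))).
  by exists d, C; rewrite PsiE E !mulmxA mulVmx // mul1mx mulmxKV.
have Psi_char c B :
  char_poly (Psi (diag_block c B)) = char_poly (diag_block c B).
  rewrite -(char_poly_conj _ Su) -phiE phi_char /= char_poly_conj //.
  by rewrite diag_block00 /diag_block block_mxKdr.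
have [Q Qu QE] := block_preserver Psi_block Psi_char m_gt1.
have Wu (d : R) : d != 0 -> diag_block d Q \in unitmx.
  move=> d0; rewrite unitmxE det_ublock det_scalar1 unitrM.
  by rewrite unitfE d0 -unitmxE.
case: QE => QE.
  have Pu : S *m diag_block 1 Q *m invmx S \in unitmx.
    by rewrite !unitmx_mul unitmx_inv Su Wu ?oner_eq0.
  exists (S *m diag_block 1 Q *m invmx S); split=> //.
    exact: diag_block_ds_span.
  left=> A; have [c [B [AE AE']]] := dsSpan_of_mx_diag_block A.
  apply: (canRL (mulmxK Pu)); rewrite {1}AE phiE QE AE'.
  rewrite !mulmxA !mulmxKV //; congr (_ *m _).
  by rewrite -!(mulmxA S) !diag_blockM mulmxKV // mulr1 mul1r.
have Pu : S *m diag_block 1 Q *m S^T \in unitmx.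
  by rewrite !unitmx_mul unitmx_tr Su Wu ?oner_eq0.
exists (S *m diag_block 1 Q *m S^T); split=> //.
  exact: adapted_conj_ds_span.
right=> A; have [c [B [AE AE']]] := dsSpan_of_mx_diag_block A.
apply: (canRL (mulmxK Pu)); rewrite {1}AE phiE QE AE'.
have -> : (S *m diag_block c B *m invmx S)^T =
    invmx S^T *m diag_block c B^T *m S^T.
  rewrite !trmx_mul trmx_inv mulmxA; congr (_ *m _ *m _).
  by rewrite /diag_block tr_block_mx tr_scalar_mx !trmx0.
rewrite !mulmxA mulmxKV // mulmxK ?unitmx_tr //; congr (_ *m _).
by rewrite -!(mulmxA S) !diag_blockM mulmxKV // mulr1 mul1r.
Qed.

Lemma ds_mx_comb (R : realType) n (a b : R) (X Y : dsSpan R n) :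
  a *: X + b *: Y = a *: (X : 'M_n) + b *: (Y : 'M_n) :> 'M_n.
Proof.
have E (Z : dsSpan R n) : ds_mx Z = val Z by [].
by rewrite !E linearD !linearZ.
Qed.

Section SizeTwo.
Variable R : realType.

Definition swap2 : 'M[R]_2 := const_mx 1 - 1%:M.

Lemma ds_span_id : (1%:M : 'M[R]_2) \in ds_span R 2.
Proof. by apply/(@ds_spanP R 1); exists 1; rewrite mul1mx mulmx1 !scale1r. Qed.

Lemma ds_span_swap2 : swap2 \in ds_span R 2.
Proof.
apply/(@ds_spanP R 1); exists 1; rewrite !scale1r mulmxBl mulmxBr mul1mx mulmx1.
by split; apply/matrixP=> i j;
  rewrite !mxE !big_ord_recl big_ord0 !mxE !mulr1 addr0 addrK.
Qed.

Lemma ds_span2P (A : 'M[R]_2) : A \in ds_span R 2 ->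
  exists p q, A = p *: 1%:M + q *: swap2.
Proof.
case/(@ds_spanP R 1) => c [Ac Ar]; exists (A 0 0), (A 0 1).
have row i : A i 0 + A i 1 = c.
  move/matrixP/(_ i 0): Ac; rewrite !mxE !big_ord_recl big_ord0 !mxE.
  by rewrite !mulr1 addr0 => <-; congr (_ + A i _); apply/val_inj.
have col : A 0 0 + A 1 0 = c.
  move/matrixP/(_ 0 0): Ar; rewrite !mxE !big_ord_recl big_ord0 !mxE.
  by rewrite !mul1r mulr1 addr0 => <-; congr (_ + A _ 0); apply/val_inj.
have row0 := row 0; have row1 := row 1.
have e10 : A 1 0 = A 0 1 by apply: (addrI (A 0 0)); rewrite col row0.
have e11 : A 1 1 = A 0 0.
  by apply: (addrI (A 1 0)); rewrite row1 -col addrC.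
apply/matrixP=> i j.
have ord2 (k : 'I_2) : k = 0 \/ k = 1.
  by case: k => [[|[|//]]] ?; [left | right]; apply: val_inj.
by case: (ord2 i) => ->; case: (ord2 j) => ->; rewrite ?e10 ?e11 !mxE /=; ring.
Qed.

Lemma mxtrace_span2 (p q : R) :
  \tr (p *: 1%:M + q *: swap2) = 2 * p /\
  \tr ((p *: 1%:M + q *: swap2) ^+ 2) = 2 * (p ^+ 2 + q ^+ 2).
Proof.
have tsw : \tr swap2 = 0.
  by rewrite /mxtrace !big_ord_recl big_ord0 !mxE /= subrr !addr0.
have swsw : swap2 *m swap2 = 1%:M.
  apply/matrixP=> i j; rewrite !mxE !big_ord_recl big_ord0 !mxE.
  by case: i => [[|[|//]]] ?; case: j => [[|[|//]]] ?; rewrite /=; ring.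
split; first by rewrite mxtraceD !mxtraceZ tsw mxtrace1 mulr0 addr0 mulrC.
rewrite expr2 -mulmxE mulmxDl !mulmxDr -!scalemxAl -!scalemxAr.
rewrite !mul1mx !mulmx1 swsw !mxtraceD !mxtraceZ tsw mxtrace1; ring.
Qed.

Lemma alt_sign_mx_involutive n : alt_sign_mx R n *m alt_sign_mx R n = 1%:M.
Proof.
rewrite /alt_sign_mx mulmx_diag -diag_const_mx; congr diag_mx.
by apply/rowP=> j; rewrite !mxE -expr2 sqrr_sign.
Qed.

Lemma alt_sign_mx_unit n : alt_sign_mx R n \in unitmx.
Proof. by case: (mulmx1_unit (alt_sign_mx_involutive n)). Qed.

(** Conjugation by diag (1, -1) changes the sign of the off-diagonal entries. *)
Lemma alt_sign_conj2 (p q : R) :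
  alt_sign_mx R 2 *m (p *: 1%:M + q *: swap2) *m invmx (alt_sign_mx R 2)
  = p *: 1%:M - q *: swap2.
Proof.
apply: (canLR (mulmxK (alt_sign_mx_unit 2))); rewrite /alt_sign_mx.
apply/matrixP=> i j; rewrite mul_diag_mx mul_mx_diag !mxE.
by case: i => [[|[|//]]] ?; case: j => [[|[|//]]] ?; rewrite /=; ring.
Qed.

(** Write phi 1 = a + b X and phi X = a' + b' X with X the swap matrix.  The
    traces give a = 1 and a' = 0; the traces of the squares then give b = 0 and
    b'^2 = 1. *)
Lemma char_poly_preserver2 (phi : {linear dsSpan R 2 -> dsSpan R 2}) :
  (forall A, char_poly (phi A) = char_poly A) ->
  exists P : 'M[R]_2, (P = 1%:M \/ P = alt_sign_mx R 2) /\
      forall A : dsSpan R 2, phi A = P *m A *m invmx P :> 'M[R]_2.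
Proof.
move=> phi_char.
have tr k (A : dsSpan R 2) : \tr ((phi A : 'M_2) ^+ k) = \tr ((A : 'M_2) ^+ k).
  exact: char_poly_eq_mxtraceX.
pose I := DsSpan ds_span_id; pose X := DsSpan ds_span_swap2.
have [a [b IE]] := ds_span2P (ds_mxP (phi I)).
have [a' [b' XE]] := ds_span2P (ds_mxP (phi X)).
have IE0 : (I : 'M_2) = 1 *: 1%:M + 0 *: swap2 by rewrite scale1r scale0r addr0.
have XE0 : (X : 'M_2) = 0 *: 1%:M + 1 *: swap2 by rewrite scale1r scale0r add0r.
have := tr 1 I; rewrite IE IE0 !expr1 !(mxtrace_span2 _ _).1 => a1.
have := tr 2 I; rewrite IE IE0 !(mxtrace_span2 _ _).2 => b0.
have := tr 1 X; rewrite XE XE0 !expr1 !(mxtrace_span2 _ _).1 => a'0.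
have := tr 2 X; rewrite XE XE0 !(mxtrace_span2 _ _).2 => b'1.
have {}a1 : a = 1 by lra.
have {}a'0 : a' = 0 by lra.
have {}b0 : b = 0.
  by apply/eqP; rewrite -sqrf_eq0; apply/eqP; move: b0; rewrite a1; lra.
have {}b'1 : b' ^+ 2 = 1 by move: b'1; rewrite a'0; lra.
have phiE p q (A : dsSpan R 2) : A = p *: 1%:M + q *: swap2 :> 'M_2 ->
    phi A = p *: 1%:M + (q * b') *: swap2 :> 'M_2.
  move=> AE; have -> : A = p *: I + q *: X.
    by apply: val_inj; rewrite [LHS]AE [RHS]ds_mx_comb.
  rewrite linearD !linearZ ds_mx_comb IE XE a1 b0 a'0.
  by rewrite !scale0r addr0 add0r scale1r scalerA.
move/eqP: b'1; rewrite sqrf_eq1 => /orP[]/eqP b'E.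
  exists 1%:M; split=> [|A]; first by left.
  have [p [q AE]] := ds_span2P (ds_mxP A).
  by rewrite (phiE p q) // AE b'E mulr1 mul1mx invmx1 mulmx1.
exists (alt_sign_mx R 2); split=> [|A]; first by right.
have [p [q AE]] := ds_span2P (ds_mxP A).
by rewrite (phiE p q) // AE alt_sign_conj2 b'E mulrN1 scaleNr.
Qed.

End SizeTwo.

Theorem theorem3p4 (R : realType) (n : nat) (hn : (2 <= n)%N)
    (phi : {linear dsSpan R n -> dsSpan R n}) :
  (forall A : dsSpan R n, spec (phi A) = spec A) <->
  ((n = 2%N /\
    exists P : 'M[R]_n, (P = 1%:M \/ P = alt_sign_mx R n) /\
      forall A : dsSpan R n, phi A = P *m A *m invmx P :> 'M[R]_n)
   \/
   ((3 <= n)%N /\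
    exists P : 'M[R]_n, [/\ P \in ds_span R n, P \in unitmx
      & (forall A : dsSpan R n, phi A = P *m A *m invmx P :> 'M[R]_n) \/
        (forall A : dsSpan R n, phi A = P *m A^T *m invmx P :> 'M[R]_n)])).
Proof.
split=> [phi_spec|].
  have phi_char A : char_poly (phi A) = char_poly A by apply/spec_eqP.
  case: n hn phi {phi_spec} phi_char => [//|[//|[|m]]] _ phi phi_char.
    by left; split=> //; apply: char_poly_preserver2.
  by right; split=> //; apply: (@char_poly_preserver_ge3 R m.+2).
case=> [[_ [P [PE phiE]]]|[_ [P [_ Pu phiE]]]] A; apply/spec_eqP.
  rewrite phiE char_poly_conj //.
  by case: PE => ->; rewrite ?unitmx1 ?alt_sign_mx_unit.
by case: phiE => ->; rewrite char_poly_conj // char_poly_trmx.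
Qed.
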